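(* Let $(\mathcal{X},P)$ be a finite irreducible Markov chain with stationary distribution $\pi$. If $t\ge \mathrm{diam}(\mathcal{X})/(k_{(\mathcal{X},P)}+3)$, then for every $o\in\mathcal{X}$, $$\left\|\log\frac{\mathscr{P}_t(o,\cdot)}{\pi(\cdot)}\right\|_{\mathrm{Lip}}\le k_{(\mathcal{X},P)}\,(k_{(\mathcal{X},P)}+1)\log\Delta(P)+k_{(\mathcal{X},P)}\log\Bigl(e-1+(k_{(\mathcal{X},P)}+3)\log\bigl(2(k_{(\mathcal{X},P)}+3)\Delta(P)\bigr)\Bigr).$$ In particular, $$\left\|\log\frac{\mathscr{P}_t(o,\cdot)}{\pi(\cdot)}\right\|_{\mathrm{Lip}}\le 3k_{(\mathcal{X},P)}^2\,(\log\Delta(P)+4).$$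
   Context: A finite irreducible Markov chain $(\mathcal{X},P)$ consists of a finite set $\mathcal{X}$ with $|\mathcal{X}|\ge2$ and an irreducible stochastic matrix $P$ on $\mathcal{X}$ (no symmetry of the support assumed). $\mathscr{P}_t(x,y)=e^{-t}\sum_{m\ge0}\frac{t^m}{m!}P^m(x,y)$. $d_P(x\to y)=\min\{k\in\mathbb{N}_0:P^k(x,y)>0\}$ (with $P^0=I$); $k_{(\mathcal{X},P)}=\max\{d_P(y\to x):d_P(x\to y)=1\}$; $\mathrm{diam}(\mathcal{X})=\max\{d_P(x\to y):x,y\in\mathcal{X}\}$; $\Delta(P)=\max\{1/P(x,y):P(x,y)>0,\ x\ne y\}$. For $f:\mathcal{X}\to\mathbb{R}$, $\|f\|_{\mathrm{Lip}}=\max\{|f(u)-f(v)|:d_P(u\to v)\le1\}$. *)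

(* Defs.v *)
From HB Require Import structures.
From mathcomp Require Import all_boot all_order all_algebra.
From mathcomp Require Import all_classical all_reals all_analysis.

Set Implicit Arguments.
Unset Strict Implicit.
Unset Printing Implicit Defensive.

Import Order.TTheory GRing.Theory Num.Theory.
Import numFieldNormedType.Exports.

Local Open Scope ring_scope.

Fixpoint kernel_pow (R : realType) (X : finType) (P : X -> X -> R) (m : nat)
    (x y : X) : R :=
  if m is m'.+1 then \sum_(z : X) P x z * kernel_pow P m' z y
  else (x == y)%:R.

Record irreducible_chain (R : realType) (X : finType) := IrreducibleChain {
  transition :> X -> X -> R;
  chain_card_gt1 : (1 < #|X|)%N;
  transition_ge0 : forall x y, 0 <= transition x y;
  transition_sum1 : forall x, \sum_(y : X) transition x y = 1;
  transition_irreducible :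
    forall x y, exists m : nat, 0 < kernel_pow transition m x y
}.

Section Chain.
Variables (R : realType) (X : finType) (P : irreducible_chain R X).

Definition stationary_distribution (mu : X -> R) : Prop :=
  [/\ forall x, 0 <= mu x, \sum_(x : X) mu x = 1
    & forall y, \sum_(x : X) mu x * P x y = mu y].

Definition heat_kernel (t : R) (x y : X) : R :=
  expR (- t) *
  limn (series (fun m : nat => t ^+ m / m`!%:R * kernel_pow P m x y)).

Definition chain_dist (x y : X) : nat := ex_minn (transition_irreducible P x y).

(* All the maxima below range over nonempty sets of nonnegative values (there
   are at least two states), so the default value 0 plays no role. *)
Definition chain_k : nat :=
  \max_(e : X * X | chain_dist e.1 e.2 == 1%N) chain_dist e.2 e.1.

Definition chain_diam : nat := \max_(e : X * X) chain_dist e.1 e.2.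

Definition chain_Delta : R :=
  \big[Num.max/0]_(e : X * X | (0 < P e.1 e.2) && (e.1 != e.2))
     (1 / P e.1 e.2).

Definition lip_norm (f : X -> R) : R :=
  \big[Num.max/0]_(e : X * X | (chain_dist e.1 e.2 <= 1)%N) `|f e.1 - f e.2|.

End Chain.

(* Main.v *)
Require Import Defs.
From HB Require Import structures.
From mathcomp Require Import all_boot all_order all_algebra.
From mathcomp Require Import all_classical all_reals all_analysis.
From mathcomp Require Import ring lra.

Set Implicit Arguments.
Unset Strict Implicit.
Unset Printing Implicit Defensive.

Import Order.TTheory GRing.Theory Num.Theory.
Import numFieldNormedType.Exports.

Local Open Scope ring_scope.

(** Write [p] for the heat kernel from [o]. Along an edge [x -> y] the Poisson
    weights [w m = t ^ m / m!] satisfy [t * w m = (m + 1) * w (m + 1)], so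
    [p x <= Delta / t * p y * E (N | X_N = y)] with [N] the number of jumps, and
    the entropy inequality gives [E (N | X_N = y) <= (e - 1) t - ln (p y)].
    A shortest path yields [p y >= e ^ (- t) * ((k + 3) Delta) ^ (- d)] with
    [d <= diam <= (k + 3) t], which bounds [p x / p y] by [Delta] times the
    argument of the second logarithm. Stationarity bounds [mu x / mu y] by
    [Delta]. Reversing an edge costs a path of at most [k] edges. *)

(** * Elementary inequalities *)

Lemma fact_le_expn (n : nat) : (n`! <= n ^ n)%N.
Proof.
elim: n => // n IH; rewrite factS expnS leq_mul2l /=.
by apply: (leq_trans IH); case: n {IH} => // n; rewrite leq_exp2r.
Qed.

Lemma ln_le_subr1 (R : realType) (x : R) : 0 < x -> ln x <= x - 1.
Proof.
by move=> x0; have := @le_ln1Dx R (x - 1); rewrite (addrC 1) subrK; apply; lra.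
Qed.

Lemma term_le_sum (R : realType) (X : finType) (F : X -> R) x :
  (forall z, 0 <= F z) -> F x <= \sum_z F z.
Proof. by move=> F0; rewrite (bigD1 x) //= lerDl sumr_ge0. Qed.

(** * Powers of a nonnegative kernel *)

Lemma kernel_pow_ge0 (R : realType) (X : finType) (P : X -> X -> R) m x y :
  (forall u v, 0 <= P u v) -> 0 <= kernel_pow P m x y.
Proof.
move=> P0; elim: m x => [|m IH] x /=; first by rewrite ler0n.
by apply: sumr_ge0 => z _; rewrite mulr_ge0.
Qed.

Lemma kernel_pow_le1 (R : realType) (X : finType) (P : X -> X -> R) m x y :
  (forall u v, 0 <= P u v) -> (forall u, \sum_v P u v = 1) ->
  kernel_pow P m x y <= 1.
Proof.
move=> P0 P1; elim: m x => [|m IH] x /=; first by case: eqP.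
rewrite -[leRHS](P1 x); apply: ler_sum => z _.
by rewrite ler_piMr.
Qed.

(** The definition splits off the first step; comparing [P^m(o, x)] with [P^(m+1)(o, y)] along an
    edge needs the last one. *)
Lemma kernel_powSr (R : realType) (X : finType) (P : X -> X -> R) m x y :
  kernel_pow P m.+1 x y = \sum_z kernel_pow P m x z * P z y.
Proof.
elim: m x y => [|m IH] x y.
  rewrite /= (bigD1 y) //= eqxx mulr1 big1 ?addr0; last first.
    by move=> z /negbTE ->; rewrite mulr0.
  rewrite (bigD1 x) //= eqxx mul1r big1 ?addr0 // => z.
  by rewrite eq_sym => /negbTE ->; rewrite mul0r.
transitivity (\sum_z P x z * kernel_pow P m.+1 z y); first by [].
under eq_bigr do rewrite IH big_distrr /=.
rewrite exchange_big /=; apply: eq_bigr => z _.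
by rewrite big_distrl /=; apply: eq_bigr => w _; rewrite mulrA.
Qed.

Lemma kernel_powS_gt0 (R : realType) (X : finType) (P : X -> X -> R) m x y :
  (forall u v, 0 <= P u v) -> 0 < kernel_pow P m.+1 x y ->
  exists z, 0 < P x z /\ 0 < kernel_pow P m z y.
Proof.
move=> P0 /= sum_gt0; have /existsP[z] : [exists z, 0 < P x z * kernel_pow P m z y].
  apply: contraTT sum_gt0 => /existsPn no.
  by rewrite -leNgt; apply: sumr_le0 => z _; rewrite leNgt.
rewrite lt0r mulf_eq0 negb_or => /andP[/andP[xz zy] _]; exists z.
by rewrite !lt0r xz zy P0 kernel_pow_ge0.
Qed.

(** Each step of a path of positive probability costs one factor [a]; [edge] covers holding steps as
    well, since the path may contain them. *)
Lemma kernel_pow_path_le (R : realType) (X : finType) (P : X -> X -> R)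
    (f : X -> R) (a : R) m x y :
  (forall u v, 0 <= P u v) -> 0 <= a ->
  (forall u v, 0 < P u v -> f u <= a * f v) ->
  0 < kernel_pow P m x y -> f x <= a ^+ m * f y.
Proof.
move=> P0 a0 edge; elim: m x => [|m IH] x.
  by rewrite /=; case: eqP => [->|_]; rewrite ?ltxx // mul1r.
move=> /(kernel_powS_gt0 P0)[z [xz zy]].
rewrite exprS -mulrA; apply: (le_trans (edge _ _ xz)).
by rewrite ler_wpM2l // IH.
Qed.

(** * Distances and extremal constants of the chain *)

Lemma transition_le1 (R : realType) (X : finType)
    (P : irreducible_chain R X) x y : P x y <= 1.
Proof.
by rewrite -(transition_sum1 P x); apply: term_le_sum => z; apply: transition_ge0.
Qed.

Lemma chain_dist_gt0 (R : realType) (X : finType)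
    (P : irreducible_chain R X) x y : x != y -> (0 < chain_dist P x y)%N.
Proof.
rewrite /chain_dist; case: ex_minnP => -[|m] //= + _.
by case: eqP; rewrite ?ltxx.
Qed.

Lemma kernel_pow_chain_dist_gt0 (R : realType) (X : finType)
    (P : irreducible_chain R X) x y :
  0 < kernel_pow P (chain_dist P x y) x y.
Proof. by rewrite /chain_dist; case: ex_minnP. Qed.

Lemma chain_dist_eq1P (R : realType) (X : finType)
    (P : irreducible_chain R X) x y :
  x != y -> reflect (0 < P x y) (chain_dist P x y == 1%N).
Proof.
move=> ne; have E : kernel_pow P 1 x y = P x y.
  rewrite kernel_powSr (bigD1 x) //= eqxx mul1r big1 ?addr0 // => z.
  by rewrite eq_sym => /negbTE ->; rewrite mul0r.
apply: (iffP eqP) => [d1|xy].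
  by rewrite -E -[X in kernel_pow _ X]d1 kernel_pow_chain_dist_gt0.
apply/eqP; rewrite eqn_leq chain_dist_gt0 // andbT.
by rewrite /chain_dist; case: ex_minnP => d _; apply; rewrite E.
Qed.

(** The product form avoids dividing by [chain_Delta P], whose positivity is itself derived from
    this bound. *)
Lemma chain_Delta_edge (R : realType) (X : finType)
    (P : irreducible_chain R X) x y :
  0 < P x y -> x != y -> 1 <= chain_Delta P * P x y.
Proof.
move=> xy ne; rewrite -ler_pdivrMr //.
by apply: (@le_bigmax_cond _ _ _ _ (x, y) _ (fun e => 1 / P e.1 e.2)); apply/andP.
Qed.

(** A walk between two distinct states must at some point leave its starting state; the induction
    discards the initial holding steps. *)
Lemma exists_chain_edge (R : realType) (X : finType)
    (P : irreducible_chain R X) : exists x y, x != y /\ 0 < P x y.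
Proof.
have /card_gt1P[x [y [_ _ ne]]] := chain_card_gt1 P.
have [m] := transition_irreducible P x y.
elim: m x ne => [|m IH] x ne; first by rewrite /= (negbTE ne) ltxx.
move=> /(kernel_powS_gt0 (@transition_ge0 _ _ P))[z [xz zy]].
have [zx|] := eqVneq x z; last by exists x, z.
by apply: (IH x ne); rewrite zx.
Qed.

Lemma chain_Delta_ge1 (R : realType) (X : finType)
    (P : irreducible_chain R X) : 1 <= chain_Delta P.
Proof.
have [x [y [ne xy]]] := exists_chain_edge P.
have DP := chain_Delta_edge xy ne.
apply: (le_trans DP); rewrite ler_piMr ?transition_le1 //.
by rewrite ltW // -(pmulr_lgt0 _ xy) (lt_le_trans ltr01).
Qed.

Lemma chain_k_gt0 (R : realType) (X : finType)
    (P : irreducible_chain R X) : (0 < chain_k P)%N.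
Proof.
have [x [y [ne xy]]] := exists_chain_edge P.
apply: (@leq_trans (chain_dist P y x)); first by rewrite chain_dist_gt0 // eq_sym.
rewrite /chain_k.
by apply: (@leq_bigmax_cond _ _ (fun e => chain_dist P e.2 e.1) (x, y)); apply/chain_dist_eq1P.
Qed.

Lemma chain_dist_le_diam (R : realType) (X : finType)
    (P : irreducible_chain R X) x y : (chain_dist P x y <= chain_diam P)%N.
Proof. exact: (@leq_bigmax _ (fun e => chain_dist P e.1 e.2) (x, y)). Qed.

Lemma chain_diam_gt0 (R : realType) (X : finType)
    (P : irreducible_chain R X) : (0 < chain_diam P)%N.
Proof.
have [x [y [ne _]]] := exists_chain_edge P.
exact: leq_trans (chain_dist_gt0 P ne) (chain_dist_le_diam P x y).
Qed.

(* Steps holding in place are dropped, since [chain_Delta] does not control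
   the diagonal of [P]. *)
Lemma kernel_pow_loopless (R : realType) (X : finType)
    (P : irreducible_chain R X) m x y :
  0 < kernel_pow P m x y ->
  exists2 j, (j <= m)%N & 1 <= chain_Delta P ^+ j * kernel_pow P j x y.
Proof.
have P0 := @transition_ge0 _ _ P.
elim: m x => [|m IH] x.
  by rewrite /=; case: eqP; rewrite ?ltxx // => xy _; exists 0%N; rewrite // xy /= eqxx mulr1.
move=> /(kernel_powS_gt0 P0)[z [xz /IH[j jm zy]]].
have [->|ne] := eqVneq x z; first by exists j; rewrite // leqW.
exists j.+1 => //.
apply: (@le_trans _ _ (chain_Delta P ^+ j.+1 * (P x z * kernel_pow P j z y))).
  by rewrite exprS mulrACA mulr_ege1 // chain_Delta_edge.
rewrite ler_wpM2l //; first by rewrite exprn_ge0 // (le_trans ler01) // chain_Delta_ge1.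
by apply: (@term_le_sum _ _ (fun z => P x z * kernel_pow P j z y)) => w;
  rewrite mulr_ge0 ?P0 ?kernel_pow_ge0.
Qed.

(** * Stationary distributions *)

(** Stationarity at [y] gives [mu x * P x y <= mu y], by keeping a single term of the sum. *)
Lemma stationary_edge_le (R : realType) (X : finType)
    (P : irreducible_chain R X) (mu : X -> R) x y :
  stationary_distribution P mu -> 0 < P x y -> mu x <= chain_Delta P * mu y.
Proof.
move=> [mu0 _ mu_eq] xy.
have [<-|ne] := eqVneq x y; first by rewrite ler_peMl ?chain_Delta_ge1.
have D0 : 0 <= chain_Delta P by rewrite (le_trans ler01) ?chain_Delta_ge1.
apply: (@le_trans _ _ (mu x * (chain_Delta P * P x y))).
  by rewrite ler_peMr // chain_Delta_edge.
rewrite mulrCA ler_wpM2l // -[leRHS]mu_eq.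
by apply: (@term_le_sum _ _ (fun x => mu x * P x y)) => z; rewrite mulr_ge0 ?transition_ge0.
Qed.

(** A zero at [x] would spread backwards along paths to every state, contradicting total mass 1. *)
Lemma stationary_gt0 (R : realType) (X : finType)
    (P : irreducible_chain R X) (mu : X -> R) x :
  stationary_distribution P mu -> 0 < mu x.
Proof.
move=> hmu; case: (hmu) => mu0 mu1 mu_eq; rewrite lt0r mu0 andbT; apply/eqP => mux.
have : \sum_y mu y = 0.
  apply: big1 => y _; have [m yx] := transition_irreducible P y x.
  apply/eqP; rewrite eq_le mu0 andbT.
  have D0 : 0 <= chain_Delta P by rewrite (le_trans ler01) ?chain_Delta_ge1.
  have := kernel_pow_path_le (@transition_ge0 _ _ P) D0
    (fun u v => @stationary_edge_le _ _ P mu u v hmu) yx.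
  by rewrite mux mulr0.
by rewrite mu1; apply/eqP; rewrite oner_eq0.
Qed.

(** * Estimates for the heat kernel *)

Lemma is_cvg_heat_series (R : realType) (X : finType)
    (P : irreducible_chain R X) (t : R) x y :
  0 <= t -> cvgn (series (fun m : nat => t ^+ m / m`!%:R * kernel_pow P m x y)).
Proof.
move=> t0; have w0 m : 0 <= t ^+ m / m`!%:R by rewrite divr_ge0 ?exprn_ge0.
have P0 := @transition_ge0 _ _ P.
apply: series_le_cvg (is_cvg_series_exp_coeff t) => m.
- by rewrite mulr_ge0 ?kernel_pow_ge0.
- exact: w0.
- by rewrite ler_piMr // kernel_pow_le1 // => u; apply: transition_sum1.
Qed.

Lemma heat_kernel_ge (R : realType) (X : finType)
    (P : irreducible_chain R X) (t : R) m x y : 0 <= t ->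
  expR (- t) * (t ^+ m / m`!%:R * kernel_pow P m x y) <= heat_kernel P t x y.
Proof.
move=> t0; rewrite /heat_kernel ler_wpM2l ?expR_ge0 //.
have w0 n : 0 <= t ^+ n / n`!%:R * kernel_pow P n x y.
  by rewrite mulr_ge0 ?kernel_pow_ge0 ?divr_ge0 ?exprn_ge0 //; apply: transition_ge0.
have mono : {homo series (fun n => t ^+ n / n`!%:R * kernel_pow P n x y) :
    n p / (n <= p)%N >-> n <= p} by apply: nondecreasing_series => n _ _.
(* The partial sum at [m.+1] is the first one that contains the term of index [m]. *)
have := nondecreasing_cvgn_le mono (@is_cvg_heat_series _ _ P t x y t0) m.+1.
apply: le_trans.
by rewrite /series /= big_nat_recr //= lerDr sumr_ge0.
Qed.

(* The entropy inequality is obtained termwise from the tangent-line bound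
   [m <= e ^ (m - c) + c - 1], with [c] the bound on [E (N | X_N = y)]. *)
Lemma heat_kernel_edge_le (R : realType) (X : finType)
    (P : irreducible_chain R X) (t : R) o x y :
  0 < t -> 0 < P x y -> x != y -> 0 < heat_kernel P t o y ->
  heat_kernel P t o x <=
  chain_Delta P * ((expR 1 - 1) - ln (heat_kernel P t o y) / t) * heat_kernel P t o y.
Proof.
move=> t_gt0 xy ne p_gt0; have t0 := ltW t_gt0; have P0 := @transition_ge0 _ _ P.
have D0 : 0 <= chain_Delta P by rewrite (le_trans ler01) ?chain_Delta_ge1.
set c := (expR 1 - 1) * t - ln (heat_kernel P t o y).
pose w (m : nat) : R := t ^+ m / m`!%:R.
have w0 m : 0 <= w m by rewrite divr_ge0 ?exprn_ge0.
pose a z m := w m * kernel_pow P m o z.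
have cvga z : cvgn (series (a z)) by apply: is_cvg_heat_series.
have a0 z m : 0 <= a z m by rewrite mulr_ge0 ?kernel_pow_ge0.
(* [b m] is [e^m * w m]: it dominates [e^m * a y m] and sums to [e^(e t)]. *)
pose b := exp_coeff (expR 1 * t).
(* Among the walks of length [m + 1] from [o] to [y], only those ending with the edge [x -> y] are
   kept. *)
have step m : t * a x m <= chain_Delta P * (m.+1%:R * a y m.+1).
  have -> : m.+1%:R * a y m.+1 = t * w m * kernel_pow P m.+1 o y.
    have m1 : m.+1%:R != 0 :> R by rewrite pnatr_eq0.
    have mf : m`!%:R != 0 :> R by rewrite pnatr_eq0 -lt0n fact_gt0.
    rewrite /a /w factS natrM exprS mulrA; congr (_ * _).
    by field; rewrite mf nat1r m1.
  rewrite /a mulrA [leRHS]mulrCA ler_wpM2l ?(mulr_ge0 t0 (w0 m)) //.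
  apply: (@le_trans _ _ (kernel_pow P m o x * (chain_Delta P * P x y))).
    by rewrite ler_peMr ?kernel_pow_ge0 // chain_Delta_edge.
  rewrite mulrCA ler_wpM2l // kernel_powSr.
  by apply: (@term_le_sum _ _ (fun z => kernel_pow P m o z * P z y)) => z;
    rewrite mulr_ge0 ?kernel_pow_ge0.
have tangent m : m%:R * a y m <= expR (- c) * b m + (c - 1) * a y m.
  have : m%:R <= expR (- c) * expR 1 ^+ m + (c - 1).
    rewrite -expRM_natl -expRD mulr1.
    by have := expR_ge1Dx (- c + m%:R); lra.
  move=> /(ler_wpM2r (a0 y m)) /le_trans; apply.
  rewrite mulrDl lerD2r -!mulrA ler_wpM2l ?expR_ge0 //.
  rewrite /b /exp_coeff /= exprMn -mulrA ler_wpM2l ?exprn_ge0 ?expR_ge0 //.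
  by rewrite ler_piMr // kernel_pow_le1 // => u; apply: transition_sum1.
(* [step] shifts the index by one, hence [n.+1] on the right; the added term [m = 0] vanishes. *)
have partial n : t * series (a x) n <=
    chain_Delta P * (expR (- c) * series b n.+1 + (c - 1) * series (a y) n.+1).
  apply: (@le_trans _ _ (chain_Delta P * \sum_(0 <= m < n.+1) m%:R * a y m)).
    rewrite big_nat_recl //= mul0r add0r /series /= !mulr_sumr.
    by apply: ler_sum => m _; apply: step.
  rewrite ler_wpM2l // /series /= !mulr_sumr -big_split /=.
  by apply: ler_sum => m _; apply: tangent.
have cvgl : (t * series (a x) n @[n --> \oo] --> t * limn (series (a x)))%classic.
  by apply: cvgMl_tmp; apply: cvga.
have cvgr : (chain_Delta P * (expR (- c) * series b n.+1 + (c - 1) * series (a y) n.+1)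
    @[n --> \oo] --> chain_Delta P *
    (expR (- c) * expR (expR 1 * t) + (c - 1) * limn (series (a y))))%classic.
  apply: cvgMl_tmp; apply: cvgD; apply: cvgMl_tmp.
    by rewrite (cvg_shiftS (series b)); apply: is_cvg_series_exp_coeff.
  by rewrite (cvg_shiftS (series (a y))); apply: cvga.
have lim_le : t * limn (series (a x)) <= chain_Delta P *
    (expR (- c) * expR (expR 1 * t) + (c - 1) * limn (series (a y))).
  by apply: (ler_cvg_to cvgl cvgr); apply: nearW.
have -> : (expR 1 - 1) - ln (heat_kernel P t o y) / t = c / t.
  by rewrite /c mulrBl mulfK // gt_eqF.
(* The choice of [c] makes [e^(-c) * e^(e t)] equal to the series mass [e^t * p y], which cancels
   the [- 1] of [c - 1]. *)
have Ec : expR (- c) * expR (expR 1 * t) = limn (series (a y)).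
  rewrite -expRD.
  have -> : - c + expR 1 * t = t + ln (heat_kernel P t o y) by rewrite /c; ring.
  by rewrite expRD lnK // /heat_kernel mulrA -expRD subrr expR0 mul1r.
have {}lim_le : t * limn (series (a x)) <= chain_Delta P * (c * limn (series (a y))).
  by move: lim_le; rewrite Ec mulrBl mul1r subrKC.
rewrite -(ler_pM2l t_gt0).
have -> : t * (chain_Delta P * (c / t) * heat_kernel P t o y) =
    expR (- t) * (chain_Delta P * (c * limn (series (a y)))).
  by rewrite /heat_kernel -/(a y); field; rewrite gt_eqF.
by rewrite /heat_kernel mulrCA ler_wpM2l ?expR_ge0.
Qed.

(** Only the series term at the length [j] of a loopless path is kept, with [j] at most the
    diameter. [K] stands for [k + 3]. *)
Lemma heat_kernel_lower (R : realType) (X : finType)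
    (P : irreducible_chain R X) (t K : R) x y :
  0 < t -> 1 <= K -> (chain_diam P)%:R <= K * t ->
  0 < heat_kernel P t x y /\
  - ln (heat_kernel P t x y) <= t + K * t * ln (K * chain_Delta P).
Proof.
move=> t_gt0 K1 diam_le; have D1 := chain_Delta_ge1 P.
have [j /leq_trans/(_ (chain_dist_le_diam P x y)) jd] :=
  kernel_pow_loopless (kernel_pow_chain_dist_gt0 P x y).
set kp := kernel_pow _ _ _ _ => one_le.
have KD : 1 <= K * chain_Delta P by rewrite mulr_ege1.
have KDj : 0 < (K * chain_Delta P) ^+ j by rewrite exprn_gt0 // (lt_le_trans ltr01).
have jKt : j%:R <= K * t by apply: le_trans diam_le; rewrite ler_nat.
have f0 : 0 < j`!%:R :> R by rewrite ltr0n fact_gt0.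
(* This is [j! <= j^j <= (K t)^j]. *)
have weight : 1 <= K ^+ j * (t ^+ j / j`!%:R).
  rewrite mulrA -exprMn ler_pdivlMr // mul1r.
  apply: (@le_trans _ _ (j%:R ^+ j)); first by rewrite -natrX ler_nat fact_le_expn.
  by rewrite lerXn2r // nnegrE ?(le_trans _ jKt).
have low : expR (- t) <= (K * chain_Delta P) ^+ j * heat_kernel P t x y.
  have := heat_kernel_ge P j x y (ltW t_gt0).
  rewrite -/kp -(ler_pM2l KDj); apply: le_trans.
  have -> : (K * chain_Delta P) ^+ j * (expR (- t) * (t ^+ j / j`!%:R * kp)) =
    expR (- t) * ((K ^+ j * (t ^+ j / j`!%:R)) * (chain_Delta P ^+ j * kp)).
    by rewrite exprMn; ring.
  by rewrite ler_peMr ?expR_ge0 // mulr_ege1.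
have p_gt0 : 0 < heat_kernel P t x y.
  by rewrite -(pmulr_rgt0 _ KDj) (lt_le_trans _ low) // expR_gt0.
split=> //; have KDpos : 0 < K * chain_Delta P by rewrite (lt_le_trans ltr01).
have : ln (expR (- t)) <= ln ((K * chain_Delta P) ^+ j * heat_kernel P t x y).
  by rewrite ler_ln ?posrE ?expR_gt0 ?(mulr_gt0 KDj p_gt0).
rewrite expRK lnM ?posrE // lnXn // -mulr_natl => ln_low.
have := ler_wpM2r (ln_ge0 KD) jKt; lra.
Qed.

(** The lower bound on [p y] is inserted into the entropy estimate. The factor 2 inside the
    logarithm absorbs the contribution of [e^(-t)], since [1 <= 4 * ln 2 <= K * ln 2]. *)
Lemma heat_kernel_edge_ratio (R : realType) (X : finType)
    (P : irreducible_chain R X) (t K : R) o x y :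
  0 < t -> 4 <= K -> (chain_diam P)%:R <= K * t -> 0 < P x y -> x != y ->
  heat_kernel P t o x <=
  chain_Delta P * (expR 1 - 1 + K * ln (2 * K * chain_Delta P)) * heat_kernel P t o y.
Proof.
move=> t_gt0 K4 diam_le xy ne.
have K1 : 1 <= K by lra.
have [p_gt0 log_p] := heat_kernel_lower o y t_gt0 K1 diam_le.
have D1 := chain_Delta_ge1 P.
apply: (le_trans (heat_kernel_edge_le t_gt0 xy ne p_gt0)).
rewrite ler_pM2r // ler_pM2l ?(lt_le_trans ltr01) // -mulrA.
rewrite lnM ?posrE ?mulr_gt0 //; try lra.
have ln2 : 1 <= 4 * ln (2 : R).
  have := @ln_le_subr1 R 2^-1; rewrite lnV ?posrE //; lra.
rewrite lerD2l -mulNr ler_pdivrMr //; apply: (le_trans log_p).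
have := ler_wpM2r (ltW t_gt0) ln2.
have : 0 <= (K - 4) * (ln 2 * t) by rewrite !mulr_ge0 ?subr_ge0 ?(ltW t_gt0) // ln_ge0; lra.
lra.
Qed.

(** * Passage to the simplified bound *)

Lemma ratio_bound_le (R : realType) (k D : R) :
  1 <= k -> 1 <= D ->
  k * (k + 1) * ln D + k * ln (expR 1 - 1 + (k + 3) * ln (2 * (k + 3) * D))
  <= 3 * k ^+ 2 * (ln D + 4).
Proof.
move=> k1 D1; set C := expR 1 - 1 + _.
have e2 : 2 <= expR (1 : R) by have := expR_ge1Dx (1 : R); lra.
(* The tangent line at 0 gives [e^(-1/2) >= 1/2], which is then squared. *)
have e4 : expR (1 : R) <= 4.
  have half : 2^-1 <= expR (- 2^-1 : R) by have := expR_ge1Dx (- 2^-1 : R); lra.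
  have : 4^-1 <= expR (- 1 : R).
    have -> : - 1 = - 2^-1 + - 2^-1 :> R by lra.
    by rewrite expRD; nra.
  by rewrite expRN ler_pV2 ?inE ?unitfE ?expR_eq0 ?expR_gt0 //=; lra.
have l0 := ln_ge0 D1.
have D0 : 0 < D by lra.
have lnarg := @ln_le_subr1 R (2 * (k + 3) * D).
have arg0 : 1 <= 2 * (k + 3) * D by nra.
(* In [ln z <= z - 1] the [- 1] contributes [- (k + 3)], which absorbs [e - 1 <= 3]. *)
have C_le : C <= 2 * (k + 3) ^+ 2 * D by rewrite /C; have {}lnarg := lnarg ltac:(lra); nra.
have C0 : 0 < C by rewrite /C; have := ln_ge0 arg0; nra.
(* The constants come from [ln 2 <= 1] and [2 * ln (k + 3) <= 2 * (k + 2)]. *)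
have : ln C <= 2 * k + 5 + ln D.
  have : ln C <= ln (2 * (k + 3) ^+ 2 * D) by rewrite ler_ln ?posrE //; nra.
  rewrite lnM ?posrE //; last by nra.
  rewrite lnM ?posrE //; last by nra.
  rewrite lnXn; last lra.
  have := @ln_le_subr1 R 2; have := @ln_le_subr1 R (k + 3); rewrite mulr2n; lra.
move=> lnC; have k0 : 0 <= k by lra.
have := ler_wpM2l k0 lnC.
have : 0 <= k * (k - 1) * ln D by rewrite !mulr_ge0 // subr_ge0.
nra.
Qed.

(** * Logarithmic oscillation along edges and the Lipschitz bound *)

(** The edge itself gives one direction at the cost of one factor [a]; the other follows a return
    path. Both the heat kernel and [mu] are treated this way, and keeping the two directions apart
    lets a cheap one be paired with a costly one. *)
Lemma ln_edge_oscillation (R : realType) (X : finType)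
    (P : irreducible_chain R X) (f : X -> R) (a : R) u v :
  (forall x, 0 < f x) -> 1 <= a ->
  (forall x y, 0 < P x y -> x != y -> f x <= a * f y) ->
  0 < P u v -> u != v ->
  ln (f u) - ln (f v) <= ln a /\ ln (f v) - ln (f u) <= (chain_k P)%:R * ln a.
Proof.
move=> f0 a1 edge uv ne; have a0 : 0 < a := lt_le_trans ltr01 a1.
have path_back : f v <= a ^+ chain_dist P v u * f u.
  apply: (kernel_pow_path_le (@transition_ge0 _ _ P) (ltW a0) _
    (kernel_pow_chain_dist_gt0 P v u)) => x y xy.
  by have [->|/edge->//] := eqVneq x y; rewrite ler_peMl // ltW.
have dist_le : (chain_dist P v u <= chain_k P)%N.
  apply: (@leq_bigmax_cond _ _ (fun e => chain_dist P e.2 e.1) (u, v)).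
  exact/chain_dist_eq1P.
have log_le b x y : 0 < b -> f x <= b * f y -> ln (f x) - ln (f y) <= ln b.
  move=> b0 xy; rewrite lerBlDr -lnM ?posrE // ler_ln ?posrE //.
  by rewrite mulr_gt0.
split; first by apply: log_le => //; apply: edge.
apply: (le_trans (log_le _ _ _ (exprn_gt0 _ a0) path_back)).
by rewrite lnXn // -[leLHS]mulr_natl ler_wpM2r ?ln_ge0 // ler_nat.
Qed.

Theorem proposition2p7 (R : realType) (X : finType)
    (P : irreducible_chain R X) (mu : X -> R)
    (hmu : stationary_distribution P mu)
    (t : R) (ht : (chain_diam P)%:R / ((chain_k P)%:R + 3) <= t) (o : X) :
  let k : R := (chain_k P)%:R in
  let Delta : R := chain_Delta P in
  let L : R := lip_norm P (fun x => ln (heat_kernel P t o x / mu x)) in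
  L <= k * (k + 1) * ln Delta
       + k * ln (expR 1 - 1 + (k + 3) * ln (2 * (k + 3) * Delta))
  /\ L <= 3 * k ^+ 2 * (ln Delta + 4).
Proof.
move=> k D L.
have k1 : 1 <= k by rewrite ler1n chain_k_gt0.
have D1 : 1 <= D := chain_Delta_ge1 P.
suff main : L <= k * (k + 1) * ln D
    + k * ln (expR 1 - 1 + (k + 3) * ln (2 * (k + 3) * D)).
  by split=> //; apply: (le_trans main); apply: ratio_bound_le.
have diam0 : 0 < (chain_diam P)%:R :> R by rewrite ltr0n chain_diam_gt0.
have k3 : 0 < k + 3 by lra.
have t_gt0 : 0 < t by apply: lt_le_trans ht; rewrite divr_gt0.
have diam_le : (chain_diam P)%:R <= (k + 3) * t by rewrite mulrC -ler_pdivrMr.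
set C := expR 1 - 1 + _.
have C1 : 1 <= C.
  have := expR_ge1Dx (1 : R).
  have : 0 <= (k + 3) * ln (2 * (k + 3) * D).
    by rewrite mulr_ge0 ?(ltW k3) // ln_ge0; nra.
  by rewrite /C; lra.
have p0 x : 0 < heat_kernel P t o x.
  by have [|//] := heat_kernel_lower o x t_gt0 _ diam_le; lra.
have mu0 x : 0 < mu x := stationary_gt0 x hmu.
have DC1 : 1 <= D * C by rewrite mulr_ege1.
have lnDC : ln (D * C) = ln D + ln C by rewrite lnM ?posrE //; lra.
have lD := ln_ge0 D1; have lC := ln_ge0 C1.
have kk : 0 <= k * (k - 1) * ln D by rewrite !mulr_ge0 ?subr_ge0 //; lra.
have kD : 0 <= (k - 1) * ln D by rewrite mulr_ge0 ?subr_ge0.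
have kC : 0 <= (k - 1) * ln C by rewrite mulr_ge0 ?subr_ge0.
(* The bound must also dominate the default value 0 of the maximum in [lip_norm]. *)
have bound0 : 0 <= k * (k + 1) * ln D + k * ln C.
  by rewrite addr_ge0 ?mulr_ge0 //; lra.
rewrite /L /lip_norm; apply: bigmax_le => // -[u v] /=.
have [->|ne] := eqVneq u v; first by rewrite subrr normr0.
rewrite leq_eqVlt [X in _ || X]ltnNge chain_dist_gt0 // orbF => /(chain_dist_eq1P P ne) uv.
have [heat_uv heat_vu] := ln_edge_oscillation p0 DC1
  (fun x y => @heat_kernel_edge_ratio _ _ P t (k + 3) o x y t_gt0 ltac:(lra) diam_le) uv ne.
have [mu_uv mu_vu] := ln_edge_oscillation mu0 D1
  (fun x y xy _ => stationary_edge_le hmu xy) uv ne.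
rewrite -/k lnDC in heat_uv heat_vu mu_vu.
(* Forward heat pairs with backward [mu], giving [(k + 1) * ln D + ln C]; the opposite pairing gives
   [(k + 1) * ln D + k * ln C]. Both lie below the target because [k >= 1]. *)
rewrite !ln_div ?posrE // ler_norml; apply/andP; split; nra.
Qed.
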